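(* The alternating group $A_5$ is wexp-solvable.
   Context: Let $G$ be a finite group. A subgroup $H \le G$ is called weakly exponential with respect to $G$ if, for all $x \in G$, there exists $g \in G$ such that $x^{|G:H|} \in H^g$, where $H^g = g^{-1}Hg$. The group $G$ is called wexp-solvable if every subgroup of $G$ is weakly exponential with respect to $G$. *)

(* Defs.v *)
From mathcomp Require Import all_boot all_fingroup all_solvable.
Set Implicit Arguments.
Unset Strict Implicit.
Unset Printing Implicit Defensive.
Local Open Scope group_scope.

Definition weakly_exponential (gT : finGroupType) (G H : {group gT}) : Prop :=
  forall x : gT, x \in G -> exists2 g : gT, g \in G & x ^+ #|G : H| \in H :^ g.

Definition wexp_solvable (gT : finGroupType) (G : {group gT}) : Prop :=
  forall H : {group gT}, H \subset G -> weakly_exponential G H.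

(* Main.v *)
Require Import Defs.
From mathcomp Require Import all_boot all_fingroup all_solvable.
From mathcomp Require Import zify.

(** Every nontrivial element of A_5 has prime order, and any finite group with
    that property is wexp-solvable: given H <= G and x of prime order p, either
    p divides |G : H| and x ^ |G : H| = 1, or a Sylow p-subgroup of H is already
    one of G, so that some conjugate of H contains x ([prime_order_wexp_solvable]).

    For the orders in A_5, let x be an even permutation of five points.  The
    parity of x is that of 5 minus its number of cycles, so that number is odd.
    The ways to write 5 as an odd number of positive summands are 5, 3+1+1,
    2+2+1 and 1+1+1+1+1; in each of them all the cycle lengths divide one of the
    primes 5, 3, 2 ([odd_parts_of_five]), which is thus an exponent of x. *)

Local Open Scope group_scope.

(** A power of x coprime to the order of x generates the same subgroup, so when
    p does not divide |G : H| the claim says that H meets every class of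
    elements of order p; this holds because H then contains a full Sylow
    p-subgroup of G. *)
Lemma prime_order_wexp_solvable (gT : finGroupType) (G : {group gT}) :
  (forall x, x \in G -> exists2 p, prime p & x ^+ p = 1) -> wexp_solvable G.
Proof.
move=> ordG H sHG x Gx; have [p p_pr xp1] := ordG x Gx.
have [/dvdnP[k ->] | p'GH] := boolP (p %| #|G : H|).
  by exists 1; rewrite // mulnC expgM xp1 expg1n group1.
have [P sylP] := Sylow_exists p H.
have sylGP : p.-Sylow(G) P.
  have [sPH pP p'HP] := and3P sylP.
  apply/and3P; split=> //; first exact: subset_trans sPH sHG.
  by rewrite -(Lagrange_index sHG sPH) pnatM p'HP p'natE ?p'GH.
have p_x : p.-group <[x]>.
  by apply: (pnat_dvd (n := p)); rewrite ?pnat_id // -/(order x) order_dvdn xp1.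
have sxG : <[x]> \subset G by rewrite cycle_subG.
have [g Gg sxPg] := Sylow_subJ sylGP sxG p_x.
exists g => //; apply: groupX; rewrite -cycle_subG.
by apply: subset_trans sxPg _; rewrite conjSg (pHall_sub sylP).
Qed.

(** The only partitions of 5 whose parts have no common prime multiple are 4+1
    and 3+2, and these have an even number of parts. *)
Lemma odd_parts_of_five (s : seq nat) :
    odd (size s) -> all (leq 1) s -> sumn s = 5 ->
  exists2 p, prime p & all (fun k => k %| p) s.
Proof.
move=> odd_s pos_s sum_s.
have size_s : size s <= 5.
  rewrite -sum_s; elim: s pos_s {odd_s sum_s} => //= k s IHs /andP[k_gt0 /IHs].
  by rewrite -add1n; apply: leq_add.
case: s odd_s pos_s sum_s size_s => [|a [|b [|c [|d [|e [|? ?]]]]]] //=.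
- by rewrite addn0 => _ _ -> _; exists 5.
- case: a => [|[|[|[|a]]]] //; case: b => [|[|[|[|b]]]] //;
    case: c => [|[|[|[|c]]]] //= _ _ sum_s _; try lia;
    by [exists 2 | exists 3].
- move=> _ pos_s sum_s _; exists 2 => //.
  by have [-> -> -> -> ->] : [/\ a = 1, b = 1, c = 1, d = 1 & e = 1]%N
    by split; lia.
Qed.

Lemma sum_card_porbits (T : finType) (x : {perm T}) :
  \sum_(B in porbits x) #|B| = #|T|.
Proof.
rewrite -cardsT; symmetry; apply: card_partition.
have -> : porbits x = [set orbit 'P <[x]> y | y in [set: T]].
  by apply/setP => B; apply/imsetP/imsetP => -[y _ ->]; exists y;
    rewrite ?porbitE ?in_setT.
by apply: orbit_partition; apply/subsetP => y _; rewrite !inE;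
  apply/subsetP => z; rewrite !inE.
Qed.

Lemma perm_expg_eq1 (T : finType) (x : {perm T}) n :
  (forall y, #|porbit x y| %| n) -> x ^+ n = 1.
Proof.
move=> dvd_n; apply/permP => y; rewrite perm1 permX.
by have /dvdnP[k ->] := dvd_n y; elim: k => // k IHk;
  rewrite mulSn iterD IHk iter_porbit.
Qed.

Theorem lemma5p2 : wexp_solvable 'Alt_('I_5)%G.
Proof.
apply: prime_order_wexp_solvable => x; rewrite Alt_even /odd_perm card_ord.
rewrite addTb negbK => odd_cycles.
have [||| p p_pr dvd_p] :=
  @odd_parts_of_five [seq #|B| | B : {set 'I_5} in porbits x].
- by rewrite size_map -cardE.
- apply/allP => _ /imageP[_ /imsetP[y _ ->] ->].
  by rewrite lt0n card_porbit_neq0.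
- by rewrite sumnE big_image /= sum_card_porbits card_ord.
exists p => //; apply: perm_expg_eq1 => y.
by apply: (allP dvd_p); apply: image_f; apply: imset_f.
Qed.
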